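(* Let $n$ be a positive integer with $2pq\mid n$, where $p$ and $q$ are two distinct odd primes, and let $S\subseteq\mathbb{Z}_n\setminus\{0\}$ with $S=-S$ (elements viewed as integers in $\{1,\ldots,n-1\}$). If the complement of the circulant graph $\mathrm{Cay}(\mathbb{Z}_n,S)$ exhibits PGFR, then there exists $y\in S$ such that $p\mid y$ or $q\mid y$.
   Context: The circulant graph $\mathrm{Cay}(\mathbb{Z}_n,S)$ has vertex set $\mathbb{Z}_n$, two distinct vertices $a,b$ being adjacent iff $b-a\in S$; its complement is $\mathrm{Cay}(\mathbb{Z}_n,\mathbb{Z}_n\setminus(S\cup\{0\}))$. For a graph $\Gamma$ with adjacency matrix $A$, the transition matrix is $H(t)=\exp(-\mathbf{i}tA)$, $t\in\mathbb{R}$, and $\mathbf{e}_v$ is the standard basis vector of vertex $v$. $\Gamma$ exhibits pretty good fractional revival (PGFR) between distinct vertices $a$ and $b$ if there is a sequence of real numbers $\{t_k\}$ with $\lim_{k\to\infty}H(t_k)\mathbf{e}_a=\alpha\mathbf{e}_a+\beta\mathbf{e}_b$ for some $\alpha,\beta\in\mathbb{C}$ with $\beta\neq0$ and $|\alpha|^2+|\beta|^2=1$; $\Gamma$ exhibits PGFR if it does so between some pair of distinct vertices. *)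

(* Defs.v *)
From HB Require Import structures.
From mathcomp Require Import all_boot all_order all_algebra.
From mathcomp Require Import complex.
From mathcomp Require Import all_classical all_reals all_analysis.

Set Implicit Arguments.
Unset Strict Implicit.
Unset Printing Implicit Defensive.

Import Order.TTheory GRing.Theory Num.Theory.
Import numFieldTopology.Exports numFieldNormedType.Exports.
Local Open Scope classical_set_scope.
Local Open Scope complex_scope.
Local Open Scope ring_scope.

(* The library puts the topology of the norm `|z| on R[i]^o only; this makes *)
(* it canonical on R[i], so that 'M[R[i]]_(m, k) gets the entrywise topology. *)
HB.instance Definition _ (R : realType) := NormedModule.copy R[i] R[i]^o.

Definition expmx (R : realType) (m : nat) (M : 'M[R[i]]_m) : 'M[R[i]]_m :=
  lim ((\sum_(0 <= j < k) (j`!%:R)^-1 *: M ^+ j) @[k --> \oo]).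

(* A graph on the vertex set 'I_m is given by its adjacency relation. *)
Definition adjmx (R : realType) (m : nat) (e : rel 'I_m) : 'M[R[i]]_m :=
  \matrix_(a, b) (e a b)%:R.

Definition transmx (R : realType) (m : nat) (e : rel 'I_m) (t : R) :
  'M[R[i]]_m := expmx ((- 'i%C * t%:C) *: adjmx R e).

Definition basis_vec (R : realType) (m : nat) (v : 'I_m) : 'cV[R[i]]_m :=
  delta_mx v 0.

Definition pgfr_between (R : realType) (m : nat) (e : rel 'I_m)
    (a b : 'I_m) : Prop :=
  exists (t : nat -> R) (alpha beta : R[i]),
    [/\ (transmx e (t k) *m basis_vec R a) @[k --> \oo] -->
          alpha *: basis_vec R a + beta *: basis_vec R b,
        beta != 0 & `|alpha| ^+ 2 + `|beta| ^+ 2 = 1].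

Definition pgfr (R : realType) (m : nat) (e : rel 'I_m) : Prop :=
  exists a b : 'I_m, a != b /\ pgfr_between R e a b.

(* 'Z_n is the ring of integers mod n only for 1 < n. *)
Definition cay (n : nat) (S : {set 'Z_n}) : rel 'Z_n :=
  [rel a b : 'Z_n | (a != b) && (b - a \in S)].

Definition compl_graph (T : eqType) (e : rel T) : rel T :=
  [rel a b | (a != b) && ~~ e a b].

Lemma compl_cay (n : nat) (S : {set 'Z_n}) :
  compl_graph (cay S) =2 cay (~: (0 |: S)).
Proof.
move=> a b; rewrite /compl_graph /cay /= !inE subr_eq0 [b == a]eq_sym.
by case: eqVneq.
Qed.

(* Main.v *)
(** The Fourier matrix diagonalises [transmx (cay T) t], with eigenvalues
    [cis (- t lambda_j)] where [lambda_j = \sum_(s in T) w^(s j)] is real.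
    Hence PGFR from [a] to [b] along [t_k] says that
    [cis (- t_k lambda_j)] tends to [alpha + beta z^j] for all [j], with
    [z = w^(b - a)]. Since [lambda_(-j) = lambda_j], [z^2 = 1] and so [z = -1].
    If no element of [S] is divisible by a divisor [d] of [n], the eigenvalues
    of [Cay(Z_n, S)] sum to zero over every progression
    [j, j + n/d, ..., j + (d-1)n/d], so those of the complement sum to [-d]
    unless [n/d] divides [j]. When [n/d] is even and greater than 2, multiplying
    the limits over the progressions of [j = 1] and [j = 2] gives
    [(alpha - beta)^d = (alpha + beta)^d]. For [d = p] and [d = q], which are
    coprime, this forces [beta = 0]. *)
Require Import Defs.
From mathcomp Require Import all_boot all_order all_algebra.
From mathcomp Require Import cyclic separable cyclotomic complex.
From mathcomp Require Import all_classical all_reals all_analysis.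

Set Implicit Arguments.
Unset Strict Implicit.
Unset Printing Implicit Defensive.

Import Order.TTheory GRing.Theory Num.Theory.
Import numFieldTopology.Exports numFieldNormedType.Exports.
Local Open Scope classical_set_scope.
Local Open Scope complex_scope.
Local Open Scope ring_scope.

(** * Entrywise limits of matrices and the exponential of an imaginary number *)

Lemma cvg_mx (T : topologicalType) (m k : nat) (I : Type) (F : set_system I)
    {FF : Filter F} (u : I -> 'M[T]_(m, k)) (L : 'M[T]_(m, k)) :
  (forall i j, u x i j @[x --> F] --> L i j) -> u x @[x --> F] --> L.
Proof.
move=> uL A [B LB sBA] /=.
have : \forall x \near F, forall i j, B i j (u x i j).
  by apply: filter_forall => i; apply: filter_forall => j; apply: uL (LB i j).
by apply: filterS => x Bx; apply: sBA.
Qed.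

Lemma cvg_mx_coord (K : numFieldType) (m k : nat) (I : Type) (F : set_system I)
    {FF : Filter F} (u : I -> 'M[K]_(m, k)) (L : 'M[K]_(m, k)) i j :
  u x @[x --> F] --> L -> u x i j @[x --> F] --> L i j.
Proof.
by move=> uL A LA; apply: (uL _ (@coord_continuous K m k i j L A LA)).
Qed.

Lemma cvg_real_complex (R : realType) (u : nat -> R) (l : R) :
  u x @[x --> \oo] --> l -> ((u x)%:C : R[i]) @[x --> \oo] --> l%:C.
Proof.
move=> /cvgrPdist_lt ul; apply/cvgrPdist_lt => e.
(* In the order of [R[i]], [0 < e] means zero imaginary part and positive real part, so [e] serves
   as a real epsilon. *)
rewrite ltcE /= => /andP[/eqP e0 e_gt0].
have := ul _ e_gt0; apply: filterS => k lk.
rewrite -rmorphB normc_def /= expr0n addr0 sqrtr_sqr.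
by rewrite ltcE /= e0 eqxx.
Qed.

Definition cis (R : realType) (x : R) : R[i] := cos x +i* sin x.

Lemma cisD (R : realType) (x y : R) : cis (x + y) = cis x * cis y.
Proof.
rewrite /cis cosD sinD; apply/eqP; rewrite eq_complex /=.
by rewrite eqxx addrC eqxx.
Qed.

Lemma cis0 (R : realType) : cis (0 : R) = 1.
Proof. by rewrite /cis cos0 sin0. Qed.

Lemma cis_sum (R : realType) (I : Type) (r : seq I) (f : I -> R) :
  cis (\sum_(i <- r) f i) = \prod_(i <- r) cis (f i).
Proof. exact: (big_morph (@cis R) (@cisD R) (@cis0 R)). Qed.

(** Even powers of $ix$ give the cosine series and odd ones $i$ times the sine series. Each
    coefficient sequence vanishes at the other parity, so the partial sums agree term by term. *)
Lemma cvg_exp_imag (R : realType) (x : R) :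
  (\sum_(0 <= j < k) (j`!%:R)^-1 * ('i%C * x%:C) ^+ j : R[i])
    @[k --> \oo] --> cis x.
Proof.
have -> : (fun k => \sum_(0 <= j < k) (j`!%:R)^-1 * ('i%C * x%:C) ^+ j : R[i])
    = (fun k => (series (cos_coeff x) k)%:C +
                'i%C * (series (sin_coeff x) k)%:C).
  apply/funext => k; rewrite /series /= !rmorph_sum /= mulr_sumr -big_split /=.
  apply: eq_bigr => j _; rewrite /cos_coeff /sin_coeff /= exprMn.
  rewrite -[in 'i%C ^+ j](odd_double_half j).
  rewrite exprD -muln2 mulnC exprM sqr_i.
  rewrite !rmorphM !rmorphXn !rmorphV ?unitfE ?pnatr_eq0 -?lt0n ?fact_gt0 //.
  have natC l : (l%:R : R)%:C = l%:R by exact: rmorph_nat.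
  rewrite rmorphN1 /= !natC [LHS]mulrC !mulrA.
  case: (boolP (odd j)) => oj /=.
    have -> : j.-1./2 = j./2.
      by rewrite -[j]odd_double_half oj /= uphalf_double doubleK.
    by rewrite !mul0r add0r !mulr1.
  by rewrite mulr0 !mul0r addr0.
have -> : cis x = (cos x)%:C + 'i%C * (sin x)%:C.
  by rewrite [LHS]complexE.
apply: cvgD.
  apply: cvg_real_complex; rewrite unlock; exact: is_cvg_series_cos_coeff.
apply: cvgM; first exact: cvg_cst.
apply: cvg_real_complex; rewrite unlock; exact: is_cvg_series_sin_coeff.
Qed.

(** The partial sums are $F^{-1}D_k$, where $D_k$ is $F$ with its rows scaled by scalar exponential
    sums. So invertibility of $F$ yields the convergence without which the [lim] in [expmx] says
    nothing. *)
Lemma expmx_eigen (R : realType) (m : nat) (F M : 'M[R[i]]_m)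
    (theta : 'I_m -> R) :
  F \in unitmx ->
  (forall i, row i F *m M = ('i%C * (theta i)%:C) *: row i F) ->
  forall i, row i F *m expmx M = cis (theta i) *: row i F.
Proof.
move=> Fu FM.
pose z i : R[i] := 'i%C * (theta i)%:C.
pose P k := \sum_(0 <= j < k) (j`!%:R)^-1 *: M ^+ j.
pose s i k : R[i] := \sum_(0 <= j < k) (j`!%:R)^-1 * z i ^+ j.
have Fpow i j : row i F *m M ^+ j = z i ^+ j *: row i F.
  elim: j => [|j IH]; first by rewrite expr0 scale1r mulmx1.
  by rewrite exprSr mulmxA IH -scalemxAl FM scalerA -exprSr.
have FP i k : row i F *m P k = s i k *: row i F.
  rewrite /P /s mulmx_sumr scaler_suml; apply: eq_bigr => j _.
  by rewrite -scalemxAr Fpow scalerA.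
pose D k := \matrix_(i, j) (s i k * F i j).
have PE k : P k = invmx F *m D k.
  rewrite -[LHS](mulKmx Fu); congr (_ *m _); apply/row_matrixP => i.
  by rewrite row_mul FP; apply/rowP => j; rewrite !mxE.
pose D' := \matrix_(i, j) (cis (theta i) * F i j).
have PL : P k @[k --> \oo] --> invmx F *m D'.
  apply: cvg_mx => i j; under eq_fun do rewrite PE mxE.
  rewrite mxE; apply: (cvg_big add_continuous) => l _; rewrite !mxE.
  under eq_fun do rewrite mxE.
  apply: cvgM; first exact: cvg_cst.
  apply: cvgM; last exact: cvg_cst.
  exact: cvg_exp_imag.
have -> : expmx M = invmx F *m D'.
  apply/matrixP => i j.
  have PL' : P k @[k --> \oo] --> expmx M by apply: cvgP PL.
  by apply: (cvg_unique (@norm_hausdorff _ _)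
    (cvg_mx_coord PL') (cvg_mx_coord PL)).
move=> i; rewrite -row_mul mulKVmx //; apply/rowP => j; by rewrite !mxE.
Qed.

(** * Roots of unity and coprime exponents *)

Lemma prim_root_exists (F : closedFieldType) (n : nat) :
  n%:R != 0 :> F -> exists w : F, n.-primitive_root w.
Proof.
move=> n_neq0; have n_gt0 : (0 < n)%N by case: n n_neq0; rewrite ?eqxx.
pose P : {poly F} := 'X^n - 1; have [r Dp] := closed_field_poly_normal P.
rewrite (monicP _) ?monicXnsubC // scale1r in Dp.
have rn1 : all n.-unity_root r.
  by apply/allP => z; rewrite -root_prod_XsubC -Dp.
have sz_r : (n < (size r).+1)%N.
  by rewrite -(size_prod_XsubC r id) -Dp size_XnsubC.
have [|z] := hasP (has_prim_root n_gt0 rn1 _ sz_r); last by exists z.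
(* The $n$ roots are distinct: $X^n-1$ is separable since $n$ is nonzero in [F]. *)
by rewrite -separable_prod_XsubC -Dp separable_Xn_sub_1.
Qed.

Lemma coprime_expf_inj (F : fieldType) (p q : nat) (x y : F) :
  (0 < p)%N -> coprime p q -> x ^+ p = y ^+ p -> x ^+ q = y ^+ q -> x = y.
Proof.
move=> p_gt0 /(coprimeP _ p_gt0)[[u v] /= uv] xp xq.
have [y0|y_neq0] := eqVneq y 0.
  move/eqP: xp; rewrite y0 expr0n eqn0Ngt p_gt0 /= expf_eq0.
  by case/andP=> _ /eqP.
suff : x / y = 1 by move/(canRL (mulfVK y_neq0)); rewrite mul1r.
have yk k : x ^+ k = y ^+ k -> (x / y) ^+ k = 1.
  by move=> e; rewrite expr_div_n e divff // expf_neq0.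
(* [uv] is Bezout's identity [u * p - v * q = 1] with truncated subtraction; the difference being
   positive gives the inequality. *)
have /subnK e : (v * q <= u * p)%N by rewrite ltnW // -subn_gt0 uv.
have : (x / y) ^+ (u * p) = 1 by rewrite mulnC exprM yk // expr1n.
by rewrite -e uv exprD expr1 [(v * q)%N]mulnC exprM (yk q) // expr1n mulr1.
Qed.

Lemma sum_exp_root_eq0 (F : fieldType) (n : nat) (z : F) :
  z ^+ n = 1 -> z != 1 -> \sum_(i < n) z ^+ i = 0.
Proof.
move=> zn z1; apply/eqP; have /eqP := subrX1 z n.
by rewrite zn subrr eq_sym mulf_eq0 subr_eq0 (negPf z1).
Qed.

(** * Character sums over $\mathbb{Z}_n$ *)

Section RootPowers.
Variables (F : fieldType) (n : nat) (w : F).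
Hypotheses (n_gt1 : (1 < n)%N) (w_prim : n.-primitive_root w).

Lemma prim_root_ZpD (x y : 'Z_n) : w ^+ (x + y)%R = w ^+ x * w ^+ y.
Proof. by rewrite /= [X in (_ %% X)%N]Zp_cast // prim_expr_mod // exprD. Qed.

Lemma prim_root_ZpN (x : 'Z_n) : w ^+ (- x)%R = (w ^+ x)^-1.
Proof.
have wx : w ^+ x != 0 by rewrite expf_neq0 // (prim_root_eq0 w_prim) -lt0n ltnW.
apply: (mulfI wx); rewrite -prim_root_ZpD subrr divff //.
Qed.

Lemma prim_root_Zp_eq1 (x : 'Z_n) : (w ^+ x == 1) = (x == 0).
Proof.
rewrite -(prim_order_dvd w_prim); have := ltn_ord x.
rewrite [X in (_ < X)%N]Zp_cast //.
case: (eqVneq x 0) => [->|x0] xn; first by rewrite dvdn0.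
by rewrite gtnNdvd // lt0n.
Qed.

Lemma prim_root_exp_mod (i j : nat) : (w ^+ i) ^+ (j %% n) = (w ^+ i) ^+ j.
Proof. by rewrite -!exprM ![(i * _)%N]mulnC !exprM prim_expr_mod. Qed.

(** The index is any natural number, so that progressions need no reduction modulo $n$. *)
Definition cay_eigenvalue (T : {set 'Z_n}) (j : nat) : F :=
  \sum_(s in T) (w ^+ s) ^+ j.

Lemma cay_eigenvalue_mod T j : cay_eigenvalue T (j %% n) = cay_eigenvalue T j.
Proof. by apply: eq_bigr => s _; rewrite prim_root_exp_mod. Qed.

Lemma sum_Zp_exp_eq0 (j : nat) :
  ~~ (n %| j)%N -> \sum_(s : 'Z_n) (w ^+ s) ^+ j = 0.
Proof.
move=> n_ndvd_j; under eq_bigr => s _ do rewrite -exprM mulnC exprM.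
apply: sum_exp_root_eq0; last by rewrite -(prim_order_dvd w_prim).
by rewrite Zp_cast // -exprM mulnC exprM (prim_expr_order w_prim) expr1n.
Qed.

Lemma cay_eigenvalueN (T : {set 'Z_n}) j :
  [set - x | x in T]%SET = T ->
  \sum_(s in T) (w ^+ (- s)%R) ^+ j = cay_eigenvalue T j.
Proof.
move=> TN; rewrite /cay_eigenvalue -[in RHS]TN big_imset //=.
by move=> x y _ _; apply: oppr_inj.
Qed.

(** After exchanging the sums, each $s\in S$ contributes a multiple of a geometric sum with ratio
    $w^{s n/d}$, a $d$-th root of unity that differs from 1 because $d\nmid s$. *)
Lemma sum_cay_eigenvalue_eq0 (d : nat) (S : {set 'Z_n}) (j : nat) :
  (d %| n)%N -> (forall y, y \in S -> ~~ (d %| y)%N) ->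
  \sum_(i < d) cay_eigenvalue S (j + i * (n %/ d)) = 0.
Proof.
move=> dn Sd; rewrite exchange_big big1 //= => s /Sd ds.
under eq_bigr => i _ do rewrite exprD mulnC (exprM _ (n %/ d)).
rewrite -mulr_sumr sum_exp_root_eq0 ?mulr0 //.
  by rewrite -!exprM divnK // mulnC exprM (prim_expr_order w_prim) expr1n.
rewrite -exprM -(prim_order_dvd w_prim); apply: contra ds.
have d_gt0 : (0 < d)%N by rewrite (dvdn_gt0 (ltnW n_gt1)).
by rewrite -{1}(divnK dn) mulnC dvdn_pmul2r // divn_gt0 // dvdn_leq // ltnW.
Qed.

(** The progression keeps the class of $j$ modulo $n/d$, so it avoids multiples of $n$. There the
    full character sum vanishes, and removing $0$ and $S$ from it leaves $-1-\lambda_S$. *)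
Lemma sum_cay_eigenvalue_setC (d : nat) (S : {set 'Z_n}) (j : nat) :
    (d %| n)%N -> ~~ (n %/ d %| j)%N -> 0 \notin S ->
    (forall y, y \in S -> ~~ (d %| y)%N) ->
  \sum_(i < d) cay_eigenvalue (~: (0 |: S)) (j + i * (n %/ d)) = - d%:R.
Proof.
move=> dn jn S0 Sd.
have eqC k : ~~ (n %| k)%N ->
    cay_eigenvalue (~: (0 |: S)) k = - 1 - cay_eigenvalue S k.
  move=> nk; have := sum_Zp_exp_eq0 nk.
  rewrite (bigID (mem (0 |: S))) /= big_setU1 //= expr0 expr1n => /eqP.
  rewrite addrC addr_eq0 opprD => /eqP <-; apply: eq_bigl => s.
  by rewrite inE.
under eq_bigr => i _.
  rewrite eqC; last first.
    apply: contra jn => /(dvdn_trans (dvdn_div dn)).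
    by rewrite dvdn_addl ?dvdn_mull.
  over.
rewrite sumrB sum_cay_eigenvalue_eq0 // subr0 sumr_const card_ord.
by rewrite mulNrn.
Qed.

End RootPowers.

Lemma unity_root_conjC (C : numClosedFieldType) (n : nat) (z : C) :
  (0 < n)%N -> z ^+ n = 1 -> z^*%R = z^-1.
Proof.
move=> n_gt0 zn; suff z1 : `|z| = 1 by rewrite invC_norm z1 expr1n invr1 mul1r.
by apply/eqP; rewrite -(@pexpr_eq1 _ _ n) // -normrX zn normr1.
Qed.

(** * Spectrum of a circulant graph and its consequences for PGFR *)

Section CayleySpectrum.
Variables (R : realType) (n : nat) (w : R[i]).
Hypotheses (n_gt1 : (1 < n)%N) (w_prim : n.-primitive_root w).
Variable T : {set 'Z_n}.
Hypotheses (T0 : 0 \notin T) (TN : [set - x | x in T]%SET = T).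

Let lambda := cay_eigenvalue w T.

(** The rows are the characters of $\mathbb{Z}_n$, used as left eigenvectors. *)
Definition fourier_mx : 'M[R[i]]_((Zp_trunc n).+2) :=
  \matrix_(j, x) (w ^+ x) ^+ j.

Lemma fourier_mx_unit : fourier_mx \in unitmx.
Proof.
have -> : fourier_mx = Vandermonde _ (\row_(x < (Zp_trunc n).+2) w ^+ x).
  by apply/matrixP => j x; rewrite !mxE.
rewrite unitmxE det_Vandermonde unitfE.
apply/prodf_neq0 => x _; apply/prodf_neq0 => y xy.
rewrite !mxE subr_eq0 (eq_prim_root_expr w_prim).
have ltn_n (z : 'Z_n) : (z < n)%N by rewrite -[X in (_ < X)%N]Zp_cast.
by rewrite !modn_small ?ltn_n // gtn_eqF.
Qed.

Lemma cay_eigenvalue_real j : lambda j \is Num.real.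
Proof.
rewrite CrealE; apply/eqP; rewrite rmorph_sum /= -[RHS]cay_eigenvalueN //.
apply: eq_bigr => s _; rewrite rmorphXn /= (@unity_root_conjC _ n) 1?ltnW //.
  by rewrite prim_root_ZpN.
by rewrite -exprM mulnC exprM (prim_expr_order w_prim) expr1n.
Qed.

Lemma cay_eigenvector j :
  row j fourier_mx *m adjmx R (cay T) = lambda j *: row j fourier_mx.
Proof.
apply/rowP => y; rewrite !mxE.
under eq_bigr => x _ do rewrite !mxE.
(* The neighbours of $y$ are the $y-s$ with $s\in T$; the clause [a != b] of [cay] is automatic as
   $0\notin T$. *)
have cay_sub s : cay T (y - s) y = (s \in T).
  rewrite /cay /= opprD addrA subrr add0r opprK andb_idl // => sT.
  rewrite -[X in _ != X]subr0 (inj_eq (subrI y)).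
  by apply: contraNneq T0 => <-.
rewrite (reindex_inj (subrI y)) -[lambda j]cay_eigenvalueN //.
rewrite mulr_suml [RHS]big_mkcond; apply: eq_bigr => s _.
rewrite cay_sub; case: ifP => sT; last by rewrite mulr0.
by rewrite mulr1 -exprMn -prim_root_ZpD // addrC.
Qed.

Lemma cay_transmx j (t : R) :
  row j fourier_mx *m transmx (cay T) t =
    cis (- (t * complex.Re (lambda j))) *: row j fourier_mx.
Proof.
apply: (expmx_eigen (theta := fun j => - (t * complex.Re (lambda j)))).
  exact: fourier_mx_unit.
move=> {}j; rewrite -scalemxAr cay_eigenvector scalerA; congr (_ *: _).
have /RRe_real lE := cay_eigenvalue_real j.
by rewrite -[in LHS]lE -[LHS]mulrA mulNr -mulrN -rmorphM -rmorphN.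
Qed.

Variables (a b : 'Z_n) (t : nat -> R) (alpha beta : R[i]).
Hypothesis tH : (transmx (cay T) (t k) *m basis_vec R a) @[k --> \oo] -->
  alpha *: basis_vec R a + beta *: basis_vec R b.

(** Pair the convergent state vector with the $j$-th character, then divide by $w^{aj}$, the value
    of that character at $a$. *)
Lemma pgfr_cvg (j : nat) :
  cis (- (t k * complex.Re (lambda j))) @[k --> \oo] -->
    alpha + beta * (w ^+ (b - a)%R) ^+ j.
Proof.
wlog jn : j / (j < n)%N.
  (* Both sides are $n$-periodic in $j$, so $j$ may be taken to index a row of [fourier_mx]. *)
  move=> /(_ (j %% n)%N); rewrite ltn_mod ltnW // => /(_ isT).
  rewrite (prim_root_exp_mod w_prim).
  rewrite [lambda _](cay_eigenvalue_mod w_prim).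
  exact.
have jN : (j < (Zp_trunc n).+2)%N by rewrite Zp_cast.
pose i : 'Z_n := Ordinal jN; pose F := fourier_mx.
have w0 (x : 'Z_n) : w ^+ x != 0.
  by rewrite expf_neq0 // (prim_root_eq0 w_prim) -lt0n ltnW.
have Fb v : (row i F *m basis_vec R v) 0 0 = (w ^+ v) ^+ j.
  by rewrite -colE !mxE.
have F0 : (w ^+ a) ^+ j != 0 by rewrite expf_neq0.
have -> : (fun k => cis (- (t k * complex.Re (lambda j)))) =
    (fun k => (row i F *m (transmx (cay T) (t k) *m basis_vec R a)) 0 0
       * ((w ^+ a) ^+ j)^-1).
  apply/funext => k; rewrite mulmxA cay_transmx -scalemxAl mxE Fb.
  by rewrite mulfK.
have -> : alpha + beta * (w ^+ (b - a)%R) ^+ j =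
    (row i F *m (alpha *: basis_vec R a + beta *: basis_vec R b)) 0 0
       * ((w ^+ a) ^+ j)^-1.
  rewrite mulmxDr -!scalemxAr [X in X / _]mxE.
  rewrite [X in (X + _) / _]mxE [X in (_ + X) / _]mxE !Fb mulrDl.
  rewrite mulfK // prim_root_ZpD // prim_root_ZpN // exprMn exprVn.
  by rewrite mulrA.
apply: cvgM; last exact: cvg_cst.
under eq_fun do rewrite mxE; rewrite mxE.
apply: (cvg_big add_continuous) => l _.
apply: cvgM; first exact: cvg_cst.
exact: cvg_mx_coord tH.
Qed.

(** The indices $1$ and $n-1$ share an eigenvalue, so uniqueness of limits gives $\beta z^{-1}=\beta
    z$, while $z\neq1$ as $a\neq b$. *)
Lemma pgfr_root_eqN1 : a != b -> beta != 0 -> w ^+ (b - a)%R = - 1.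
Proof.
move=> a_neq_b beta0; set z := w ^+ (b - a)%R.
have zn : z ^+ n = 1.
  by rewrite -exprM mulnC exprM (prim_expr_order w_prim) expr1n.
have z0 : z != 0 by rewrite expf_neq0 // (prim_root_eq0 w_prim) -lt0n ltnW.
have z1 : z != 1 by rewrite (prim_root_Zp_eq1 n_gt1 w_prim) subr_eq0 eq_sym.
have exp_n1 (y : R[i]) : y ^+ n = 1 -> y ^+ n.-1 = y^-1.
  move=> yn; have y_unit : y != 0.
    apply: contra_eq_neq yn => ->.
    by rewrite expr0n gtn_eqF ?(ltnW n_gt1) // eq_sym oner_eq0.
  by apply: (mulfI y_unit); rewrite -exprS prednK ?(ltnW n_gt1) // divff.
have lambdaN : lambda n.-1 = lambda 1%N.
  rewrite /lambda -[RHS](cay_eigenvalueN _ _ TN).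
  apply: eq_bigr => s _; rewrite expr1 (prim_root_ZpN n_gt1 w_prim) exp_n1 //.
  by rewrite -exprM mulnC exprM (prim_expr_order w_prim) expr1n.
have c1 := @pgfr_cvg n.-1; rewrite lambdaN in c1.
have : alpha + beta * z ^+ n.-1 = alpha + beta * z ^+ 1.
  by apply: (cvg_unique (@norm_hausdorff _ _) c1); exact: pgfr_cvg.
move/addrI/(mulfI beta0); rewrite expr1 exp_n1 // => /(congr1 ( *%R z)).
rewrite divff // => /esym/eqP; rewrite -expr2 sqrf_eq1 (negPf z1).
by move/eqP.
Qed.

(** As $m$ is even, the sign $(-1)^{j+im}$ does not depend on $i$, so the $d$ limits coincide; the
    phases add up to $-t_k\cdot(-d)$. *)
Lemma pgfr_sum_cvg (d m j : nat) :
  ~~ odd m -> w ^+ (b - a)%R = - 1 ->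
  \sum_(i < d) lambda (j + i * m) = - d%:R ->
  cis (t k * d%:R) @[k --> \oo] --> (alpha + beta * (- 1) ^+ j) ^+ d.
Proof.
move=> m_even z_eqN1 sum_lambda.
have -> : (fun k => cis (t k * d%:R)) =
    (fun k => \prod_(i < d) cis (- (t k * complex.Re (lambda (j + i * m))))).
  apply/funext => k; rewrite -cis_sum sumrN -mulr_sumr -mulrN.
  congr (cis (_ * _)).
  apply: (@complexI R); rewrite rmorphN rmorph_sum /=.
  under eq_bigr => i _ do rewrite RRe_real ?cay_eigenvalue_real //.
  by rewrite sum_lambda opprK; exact: rmorph_nat.
have -> : (alpha + beta * (- 1) ^+ j) ^+ d =
    \prod_(i < d) (alpha + beta * (w ^+ (b - a)%R) ^+ (j + i * m)).
  rewrite -[in LHS](card_ord d) -prodr_const; apply: eq_bigr => i _.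
  rewrite z_eqN1 exprD -[(-1) ^+ (i * m)]signr_odd.
  by rewrite oddM (negPf m_even) andbF expr0 mulr1.
apply: (cvg_big mul_continuous) => i _; exact: pgfr_cvg.
Qed.

End CayleySpectrum.

(** * Contradiction from the two coprime exponents *)

Lemma adjmx_eq (R : realType) (m : nat) (e1 e2 : rel 'I_m) :
  e1 =2 e2 -> adjmx R e1 = adjmx R e2.
Proof. by move=> e12; apply/matrixP => x y; rewrite !mxE e12. Qed.

Unset Implicit Arguments.

Theorem theorem4p12 (R : realType) (n p q : nat) (n_gt0 : (0 < n)%N)
    (p_prime : prime p) (q_prime : prime q) (p_odd : odd p) (q_odd : odd q)
    (p_neq_q : p <> q) (dvd_n : (2 * p * q %| n)%N)
    (S : {set 'Z_n}) (S0 : 0 \notin S) (SN : [set - x | x in S]%SET = S)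
    (fr : pgfr R (compl_graph (cay S))) :
  exists y : 'Z_n, y \in S /\ ((p %| y)%N \/ (q %| y)%N).
Proof.
have n_gt1 : (1 < n)%N.
  apply: leq_trans (dvdn_leq n_gt0 dvd_n).
  by rewrite -mulnA leq_pmulr // muln_gt0 !prime_gt0.
have [w w_prim] : exists w : R[i], n.-primitive_root w.
  by apply: prim_root_exists; rewrite pnatr_eq0 -lt0n.
apply/not_existsP => noS.
have noSd d : d = p \/ d = q -> forall y, y \in S -> ~~ (d %| y)%N.
  by move=> dpq y yS; apply/negP => dy; apply: (noS y); split=> //;
    case: dpq dy => ->; [left|right].
set T : {set 'Z_n} := ~: (0 |: S).
have T0 : 0 \notin T by rewrite !inE eqxx.
have TN : [set - x | x in T]%SET = T.
  have memN x : (- x \in S) = (x \in S).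
    by rewrite -[in LHS]SN mem_imset //; apply: oppr_inj.
  apply/setP => x; rewrite -[x]opprK mem_imset; last exact: oppr_inj.
  by rewrite !inE !memN !oppr_eq0.
have [a [b [a_neq_b [t [alpha [beta [tH beta0 _]]]]]]] := fr.
have {}tH : (transmx (cay T) (t k) *m basis_vec R a) @[k --> \oo] -->
    alpha *: basis_vec R a + beta *: basis_vec R b.
  by rewrite /transmx -(adjmx_eq _ (@compl_cay n S)).
have wN1 := pgfr_root_eqN1 n_gt1 w_prim T0 TN tH a_neq_b beta0.
(* Here [e] is the other prime; it serves to make $n/d$ a multiple of $2e>2$. *)
have pow_eq d e : (2 * d * e %| n)%N -> (1 < e)%N -> d = p \/ d = q ->
    (alpha - beta) ^+ d = (alpha + beta) ^+ d.
  move=> de_n e_gt1 dpq.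
  have d_gt0 : (0 < d)%N by case: dpq => ->; apply: prime_gt0.
  have d_dvd : (d %| n)%N.
    by apply: dvdn_trans de_n; rewrite mulnAC dvdn_mull.
  have e2_dvd : (2 * e %| n %/ d)%N by rewrite dvdn_divRL // mulnAC.
  have nd_even : ~~ odd (n %/ d).
    by rewrite -dvdn2 (dvdn_trans _ e2_dvd) // dvdn_mulr.
  (* This bound admits both $j=1$ and $j=2$ below: neither is a multiple of $n/d$. *)
  have nd_gt2 : (2 < n %/ d)%N.
    apply: leq_trans (dvdn_leq _ e2_dvd); last by rewrite divn_gt0 // dvdn_leq.
    by rewrite (@leq_trans (2 * 2)) // leq_mul2l.
  have lim j : (0 < j < n %/ d)%N ->
      cis (t k * d%:R) @[k --> \oo] --> (alpha + beta * (- 1) ^+ j) ^+ d.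
    move=> /andP[j_gt0 j_lt].
    apply: (pgfr_sum_cvg n_gt1 w_prim T0 TN tH nd_even wN1).
    apply: (sum_cay_eigenvalue_setC n_gt1 w_prim) => //; last exact: noSd.
    by rewrite gtnNdvd.
  (* The sequence $e^{i t_k d}$ does not depend on $j$, so its limits for odd and even $j$ agree. *)
  have : (alpha + beta * (- 1) ^+ 1) ^+ d = (alpha + beta * (- 1) ^+ 2) ^+ d.
    apply: (cvg_unique (@norm_hausdorff _ _) (lim 1%N _)).
      by rewrite (ltnW nd_gt2).
    exact: lim.
  by rewrite expr1 sqrrN expr1n mulrN1 mulr1.
have := coprime_expf_inj (prime_gt0 p_prime) _
  (pow_eq p q dvd_n (prime_gt1 q_prime) (or_introl erefl))
  (pow_eq q p _ (prime_gt1 p_prime) (or_intror erefl)).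
rewrite prime_coprime // dvdn_prime2 // mulnAC.
move=> /(_ (introN eqP p_neq_q) dvd_n).
(* From $\alpha-\beta=\alpha+\beta$ follows $2\beta=0$, against $\beta\neq0$. *)
move/addrI/eqP; rewrite eq_sym -addr_eq0 -mulr2n mulrn_eq0 /=.
exact/negP.
Qed.
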